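(* Let $P$ be a non-empty finite set of primes, let $q$ be the minimum element of $P$, and let $p\in P$ be an element with minimum value of $\|p\|_{\log}$ among elements of $P$. Then: (1) the set $\{\|n\|_{P,\log} : n>1\}$ is dense in the interval $\left(\|p\|_{\log},\ \|q\|_{\log}+\frac{q-1}{\log_3 q}\right)$, i.e. every non-empty open subinterval of it contains a value $\|n\|_{P,\log}$ for some integer $n>1$; (2) for every $\epsilon>0$ there exist only finitely many integers $n>1$ such that $3 \leq \|n\|_{P,\log} < \|p\|_{\log}-\epsilon$.
   Context: For a positive integer $m$, $\|m\|$ denotes the minimum number of occurrences of the constant $1$ in an arithmetic expression built only from the constant $1$, addition, multiplication and parentheses whose value is $m$; for $m>1$, $\|m\|_{\log}=\|m\|/\log_3 m$. Given a non-empty finite set $P$ of primes, the $P$-algorithm builds an expression for $n>0$ as follows: (1) if $n=1$, represent $n$ as $1$ and stop; (2) if $n=p\in P$, represent $n$ by a shortest expression of $p$ (with $\|p\|$ ones) and stop; (3) if $n>1$, $n\notin P$ and $n$ is divisible by some $p\in P$, represent $n$ as (shortest expression of $p$)$\cdot\frac{n}{p}$ and continue with $\frac{n}{p}$; (4) if $n>1$ and $n$ is divisible by no $p\in P$, represent $n$ as $1+(n-1)$ and continue with $n-1$. The number of ones in the resulting expression does not depend on the choices made in step (3); it is denoted $\|n\|_P$. Equivalently: $\|1\|_P=1$; $\|p\|_P=\|p\|$ for $p\in P$; $\|n\|_P=\|p\|+\|n/p\|_P$ if $n>1$, $n\notin P$, $p\in P$, $p\mid n$; $\|n\|_P = 1+\|n-1\|_P$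 if $n>1$ is divisible by no element of $P$. For $n>1$, $\|n\|_{P,\log}=\|n\|_P/\log_3 n$. *)

(* Defs.v *)
From mathcomp Require Import all_boot all_order all_algebra finmap.
From mathcomp Require Import mathcomp_extra boolp classical_sets functions
  cardinality reals exp.

Set Implicit Arguments.
Unset Strict Implicit.
Unset Printing Implicit Defensive.

Import Order.TTheory GRing.Theory Num.Theory.

Local Open Scope fset_scope.
Local Open Scope classical_set_scope.
Local Open Scope nat_scope.

Inductive expr : Type :=
  | One
  | Add of expr & expr
  | Mul of expr & expr.

Fixpoint value (e : expr) : nat :=
  match e with
  | One => 1
  | Add a b => value a + value b
  | Mul a b => value a * value b
  end.

Fixpoint ones (e : expr) : nat :=
  match e with
  | One => 1
  | Add a b => ones a + ones b
  | Mul a b => ones a + ones b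
  end.

Definition shortest (m : nat) (e : expr) : Prop :=
  value e = m /\ forall e', value e' = m -> ones e <= ones e'.

(* No expression has value 0; the junk value is [complexity 0 = 0]. *)
Definition complexity (m : nat) : nat :=
  xget 0 [set k | exists2 e, shortest m e & ones e = k].

(* [Palgorithm P n e]: some run of the P-algorithm on n outputs e.  The choices
   of a shortest expression and of the prime to divide by are left free. *)
Inductive Palgorithm (P : {fset nat}) : nat -> expr -> Prop :=
  | Palg_one : Palgorithm P 1 One
  | Palg_mem (p : nat) e : p \in P -> shortest p e -> Palgorithm P p e
  | Palg_div (n p : nat) e f : 1 < n -> n \notin P -> p \in P -> p %| n ->
      shortest p e -> Palgorithm P (n %/ p) f -> Palgorithm P n (Mul e f)
  | Palg_sub n f : 1 < n -> (forall p : nat, p \in P -> ~~ (p %| n)) ->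
      Palgorithm P n.-1 f -> Palgorithm P n (Add One f).

(* When P consists of primes and n > 0, runs on n exist and all of them use the
   same number of ones: see [complexityP_run] and [Palgorithm_total]. *)
Definition complexityP (P : {fset nat}) (n : nat) : nat :=
  xget 0 [set k | exists2 e, Palgorithm P n e & ones e = k].

Lemma shortest_exists m : 0 < m -> exists e, shortest m e.
Proof.
move=> m0; have [e0 e0m] : exists e, value e = m.
  case: m m0 => // m _; elim: m => [|m [e em]]; first by exists One.
  by exists (Add One e); rewrite /= em.
have hex : exists k, `[< exists2 e, value e = m & ones e = k >].
  by exists (ones e0); apply/asboolP; exists e0.
case: (ex_minnP hex) => k /asboolP[e em ek] kmin.
exists e; split=> // e' e'm; rewrite ek; apply: kmin.
by apply/asboolP; exists e'.
Qed.

Lemma complexity_shortest m e : shortest m e -> complexity m = ones e.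
Proof.
move=> [em emin]; rewrite /complexity; case: xgetP => [k _ [f [fm fmin] <-]|].
  by apply/eqP; rewrite eqn_leq fmin // emin.
by move/(_ (ones e)) => /=; case; exists e.
Qed.

Lemma Palgorithm_total (P : {fset nat}) n :
  (forall p : nat, p \in P -> prime p) -> 0 < n -> exists e, Palgorithm P n e.
Proof.
move=> primeP; elim/ltn_ind: n => n IH n0.
have [n1|n1] := leqP n 1.
  exists One; have -> : n = 1 by apply/eqP; rewrite eqn_leq n1 n0.
  exact: Palg_one.
have [nP|nP] := boolP (n \in P).
  by have [e se] := shortest_exists n0; exists e; apply: Palg_mem.
have [[p pP pn]|np] := pselect (exists2 p : nat, p \in P & p %| n).
  have p1 := prime_gt1 (primeP _ pP); have p0 := ltnW p1.
  have np0 : 0 < n %/ p by rewrite divn_gt0 // dvdn_leq.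
  have [f fP] := IH _ (ltn_Pdiv p1 n0) np0.
  have [e se] := shortest_exists p0.
  by exists (Mul e f); apply: Palg_div se fP.
have [||f fP] := IH n.-1; [by rewrite prednK | by rewrite -ltnS prednK |].
exists (Add One f); apply: Palg_sub => // p pP; apply/negP => pn.
by apply: np; exists p.
Qed.

Lemma Palgorithm_inv (P : {fset nat}) n e : Palgorithm P n e ->
  [\/ n = 1 /\ e = One,
      n \in P /\ shortest n e,
      [/\ 1 < n, n \notin P & exists p a f, [/\ p \in P, p %| n, shortest p a,
        Palgorithm P (n %/ p) f & e = Mul a f]]
    | [/\ 1 < n, forall p : nat, p \in P -> ~~ (p %| n) &
        exists2 f, Palgorithm P n.-1 f & e = Add One f]].
Proof.
case=> [|p a pP sa|m p a f m1 mP pP pm sa fP|m f m1 mP fP].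
- exact: Or41.
- exact: Or42.
- by apply: Or43; split=> //; exists p, a, f.
- by apply: Or44; split=> //; exists f.
Qed.

Lemma shortest_ones m e f : shortest m e -> shortest m f -> ones e = ones f.
Proof. by move=> /complexity_shortest <- /complexity_shortest. Qed.

Lemma Palgorithm_ones (P : {fset nat}) n e f : (forall p : nat, p \in P -> prime p) ->
  Palgorithm P n e -> Palgorithm P n f -> ones e = ones f.
Proof.
move=> primeP; elim/ltn_ind: n e f => n IH e f.
have one_notin : 1 \notin P by apply/negP => /primeP.
move=> /Palgorithm_inv [[-> ->]|[nP se]|[n1 nP [p [a [g [pP pn sa gP ->]]]]]
    |[n1 nP [g gP ->]]] /Palgorithm_inv [[n1' ->]|[nP' sf]
    |[n1' nP' [p' [a' [g' [pP' pn' sa' gP' ->]]]]]|[n1' nP' [g' gP' ->]]] //.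
- by rewrite nP' in one_notin.
- by rewrite n1' in nP; rewrite nP in one_notin.
- exact: shortest_ones se sf.
- by rewrite nP in nP'.
- by have := nP' _ nP; rewrite dvdnn.
- by rewrite n1' in n1.
- by rewrite nP' in nP.
- have pp := primeP _ pP; have pp' := primeP _ pP'.
  have n0 := ltnW n1; rewrite /=.
  have lt := ltn_Pdiv (prime_gt1 pp) n0.
  have lt' := ltn_Pdiv (prime_gt1 pp') n0.
  have [eqp|nep] := eqVneq p p'.
    rewrite -eqp in sa' gP'.
    by rewrite (shortest_ones sa sa') (IH _ lt _ _ gP gP').
  have /dvdnP[d nE] : p * p' %| n.
    by rewrite Gauss_dvd ?pn ?pn' // prime_coprime // dvdn_prime2.
  have d0 : 0 < d by move: n0; rewrite nE muln_gt0 => /andP[].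
  have np : n %/ p = d * p' by rewrite nE mulnCA mulKn ?prime_gt0.
  have np' : n %/ p' = d * p by rewrite nE mulnA mulnK ?prime_gt0.
  have [h hP] := Palgorithm_total primeP d0.
  have key r b c : r \in P -> shortest r b -> d * r < n ->
      Palgorithm P (d * r) c -> ones c = ones b + (if d == 1 then 0 else ones h).
    move=> rP sb ltrn cP; have pr := primeP _ rP; have r0 := prime_gt0 pr.
    case: (eqVneq d 1) => [d1|d1].
      move: cP ltrn; rewrite d1 mul1n addn0 => cP ltrn.
      by apply: (IH _ ltrn c b) => //; apply: Palg_mem.
    apply: (IH _ ltrn c (Mul b h)) => //; apply: (Palg_div _ _ rP) => //.
    - by rewrite (leq_trans (prime_gt1 pr)) // leq_pmull.
    - apply/negP => /primeP drp; case/negP: d1.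
      have := dvdn_mull d (dvdnn r); rewrite dvdn_prime2 // => /eqP rE.
      by rewrite -(eqn_pmul2r r0) mul1n -rE.
    - exact: dvdn_mull.
    - by rewrite mulnK.
  rewrite np in gP lt; rewrite np' in gP' lt'.
  rewrite (key _ _ _ pP' sa' lt gP) (key _ _ _ pP sa lt' gP') /=.
  by rewrite addnCA.
- by have := nP' _ pP; rewrite pn.
- by rewrite n1' in n1.
- by have := nP _ nP'; rewrite dvdnn.
- by have := nP _ pP'; rewrite pn'.
- by rewrite /= (IH n.-1 _ _ _ gP gP') // prednK // ltnW.
Qed.

Lemma complexityP_run (P : {fset nat}) n e : (forall p : nat, p \in P -> prime p) ->
  Palgorithm P n e -> complexityP P n = ones e.
Proof.
move=> primeP eP; rewrite /complexityP; case: xgetP => [k _ [f fP <-]|].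
  exact: Palgorithm_ones fP eP.
by move/(_ (ones e)) => /=; case; exists e.
Qed.

Lemma complexityP1 (P : {fset nat}) : (forall p : nat, p \in P -> prime p) ->
  complexityP P 1 = 1.
Proof. by move=> primeP; apply: (complexityP_run primeP (Palg_one P)). Qed.

Lemma complexityP_mem (P : {fset nat}) (p : nat) : (forall p : nat, p \in P -> prime p) ->
  p \in P -> complexityP P p = complexity p.
Proof.
move=> primeP pP; have [e se] := shortest_exists (prime_gt0 (primeP _ pP)).
by rewrite (complexity_shortest se) (complexityP_run primeP (Palg_mem pP se)).
Qed.

Lemma complexityP_div (P : {fset nat}) (n p : nat) : (forall p : nat, p \in P -> prime p) ->
  1 < n -> n \notin P -> p \in P -> p %| n ->
  complexityP P n = complexity p + complexityP P (n %/ p).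
Proof.
move=> primeP n1 nP pP pn; have p0 := prime_gt0 (primeP _ pP).
have [e se] := shortest_exists p0.
have np0 : 0 < n %/ p by rewrite divn_gt0 // dvdn_leq // ltnW.
have [f fP] := Palgorithm_total primeP np0.
rewrite (complexity_shortest se) (complexityP_run primeP fP).
by rewrite (complexityP_run primeP (Palg_div n1 nP pP pn se fP)).
Qed.

Lemma complexityP_sub (P : {fset nat}) n : (forall p : nat, p \in P -> prime p) ->
  1 < n -> (forall p : nat, p \in P -> ~~ (p %| n)) ->
  complexityP P n = 1 + complexityP P n.-1.
Proof.
move=> primeP n1 nP; have n0 : 0 < n.-1 by rewrite -ltnS prednK // ltnW.
have [f fP] := Palgorithm_total primeP n0.
by rewrite (complexityP_run primeP fP) (complexityP_run primeP (Palg_sub n1 nP fP)).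
Qed.

Local Open Scope ring_scope.

Definition log3 {R : realType} (x : R) : R := ln x / ln 3.

Definition logcomplexity (R : realType) (m : nat) : R :=
  (complexity m)%:R / log3 m%:R.

Definition logcomplexityP (R : realType) (P : {fset nat}) (n : nat) : R :=
  (complexityP P n)%:R / log3 n%:R.

(* Main.v *)
Require Import Defs.
From mathcomp Require Import all_boot all_order all_algebra finmap.
From mathcomp Require Import boolp classical_sets cardinality reals sequences
  exp.
From mathcomp Require Import lra zify.

(** If every element of [P] divides [m], then on [q ^ k * m - 1] the algorithm
    goes through [k] rounds of [q - 1] subtractions followed by one division by
    [q]: for [0 < i < q], no element of [P] divides [q ^ k * m - i].  As [k]
    grows, the logarithmic complexities of these numbers tend to the upper end
    point.  Each further factor [p] adds one division of the cheapest kind, so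
    on the numbers [p ^ j * (q ^ k * m - 1)] the logarithmic complexity tends to
    the lower end point as [j] grows; when [k] is large, one factor [p] changes
    the logarithm too little, relatively, for the descent to jump over an
    interval [(a, b)].

    For the second part, a division by [r] pays for the decrease of [log3 n] at
    rate at least [logcomplexity p], and so does a subtraction once [n] is
    large, because [log3 n - log3 (n - 1)] tends to [0].  Therefore
    [logcomplexity p * log3 n - complexityP P n] is bounded above. *)

Set Implicit Arguments.
Unset Strict Implicit.
Unset Printing Implicit Defensive.

Import Order.TTheory GRing.Theory Num.Theory.
Local Open Scope fset_scope.
Local Open Scope classical_set_scope.
Local Open Scope ring_scope.

Lemma exists_nat_between (d : Order.disp_t) (T : orderType d) (u : nat -> T)
    (a b : T) :
  (a < u 0%N)%O -> (forall j, b <= u j -> a < u j.+1)%O ->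
  (exists j, u j < b)%O -> exists j, (a < u j < b)%O.
Proof.
move=> au0 ustep /ex_minnP[j ujb jmin]; exists j; rewrite ujb andbT.
case: j => [//|j] in ujb jmin *; apply: ustep; rewrite leNgt.
by apply/negP => /jmin; rewrite ltnn.
Qed.

Section Log3.
Variable R : realType.
Implicit Types x y : R.

Lemma ln3_gt0 : 0 < ln (3 : R).
Proof. by rewrite ln_gt0 // ltr1n. Qed.

Lemma log3_gt0 x : 1 < x -> 0 < log3 x.
Proof. by move=> x1; rewrite divr_gt0 ?ln3_gt0 ?ln_gt0. Qed.

Lemma log3_ge0 x : 1 <= x -> 0 <= log3 x.
Proof. by move=> x1; rewrite divr_ge0 ?ln_ge0 ?ler1n. Qed.

Lemma ler_log3 : {in Num.pos &, {mono @log3 R : x y / x <= y}}.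
Proof. by move=> x y x0 y0; rewrite ler_pM2r ?invr_gt0 ?ln3_gt0 ?ler_ln. Qed.

Lemma log3M : {in Num.pos &, {morph @log3 R : x y / x * y >-> x + y}}.
Proof. by move=> x y x0 y0; rewrite /log3 lnM // mulrDl. Qed.

Lemma log3Xn n x : 0 < x -> log3 (x ^+ n) = n%:R * log3 x.
Proof. by move=> x0; rewrite /log3 lnXn // mulr_natl mulrnAl. Qed.

Lemma log3_natXM (m k n : nat) : (0 < m)%N -> (0 < n)%N ->
  log3 ((m ^ k * n)%:R : R) = k%:R * log3 m%:R + log3 n%:R.
Proof.
move=> m0 n0; rewrite natrM natrX log3M ?posrE ?exprn_gt0 ?ltr0n //.
by rewrite log3Xn ?ltr0n.
Qed.

Lemma log3_expM_pred_bounds (m k n : nat) : (0 < m)%N -> (1 < n)%N ->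
  k%:R * log3 m%:R <= log3 ((m ^ k * n).-1%:R : R)
                   <= k%:R * log3 m%:R + log3 n%:R.
Proof.
move=> m0 n1; have mk0 : (0 < m ^ k)%N by rewrite expn_gt0 m0.
rewrite -log3_natXM ?(ltnW n1) // -log3Xn ?ltr0n // -natrX.
by rewrite !ler_log3 ?posrE ?ltr0n ?ler_nat ?leq_pred ?andbT //; nia.
Qed.

Lemma log3D1_le x : 0 < x -> log3 (x + 1) <= log3 x + (x * ln 3)^-1.
Proof.
move=> x0; have V0 : 0 < x^-1 by rewrite invr_gt0.
have -> : x + 1 = x * (1 + x^-1) by rewrite mulrDr mulr1 divff ?gt_eqF.
rewrite log3M ?posrE ?addr_gt0 // lerD2l invfM.
by rewrite ler_pM2r ?invr_gt0 ?ln3_gt0 // le_ln1Dx //; lra.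
Qed.

Lemma mulr_log3S_le x n : 0 <= x -> (0 < n)%N -> x / ln 3 <= n%:R ->
  x * log3 n.+1%:R <= x * log3 n%:R + 1.
Proof.
rewrite -(ltr0n R) => x0 n0 x_le; rewrite -natr1.
apply: le_trans (ler_wpM2l x0 (log3D1_le n0)) _.
rewrite mulrDr lerD2l ler_pdivrMr ?mulr_gt0 ?ln3_gt0 // mul1r.
by rewrite -ler_pdivrMr ?ln3_gt0.
Qed.

Lemma finite_log3_le x : finite_set [set n : nat | log3 n%:R <= x].
Proof.
apply: (@sub_finite_set _ _ `I_(Num.truncn (expR (x * ln 3))).+1); last first.
  exact: finite_II.
case=> [//|n] /=; rewrite ler_pdivrMr ?ln3_gt0 // -ler_expR.
rewrite lnK ?posrE ?ltr0n // => n_le.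
by rewrite -(ltr_nat R) (le_lt_trans n_le) // truncnS_gt.
Qed.

Lemma logcomplexity_ge0 n : (0 < n)%N -> 0 <= logcomplexity R n.
Proof. by move=> n0; rewrite divr_ge0 // log3_ge0 // ler1n. Qed.

End Log3.

Section Palgorithm.
Variable P : {fset nat}.
Hypothesis P_prime : forall r : nat, r \in P -> prime r.

Section Runs.
Local Open Scope nat_scope.

Lemma Palgorithm_step_ind (Q : nat -> Prop) :
  Q 1 -> (forall r : nat, r \in P -> Q r) ->
  (forall r n : nat, r \in P -> 1 < n -> Q n -> Q (r * n)) ->
  (forall n, 0 < n -> (forall r : nat, r \in P -> ~~ (r %| n.+1)) ->
    Q n -> Q n.+1) ->
  forall n, 0 < n -> Q n.
Proof.
move=> Q1 QP QM QS; elim/ltn_ind => n IH n0.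
have [nP|nP] := boolP (n \in P); first exact: QP.
have [[r rP rn]|n_indiv] := pselect (exists2 r : nat, r \in P & r %| n).
  have r1 := prime_gt1 (P_prime rP).
  move: rn IH n0 nP => /dvdnP[x ->] IH; rewrite muln_gt0 => /andP[x0 _] xrP.
  rewrite mulnC; apply: QM => //; last by apply: IH; nia.
  by rewrite ltn_neqAle x0 andbT; apply: contra xrP => /eqP <-; rewrite mul1n.
case: n => [//|[//|n]] in IH n0 nP n_indiv *; apply: QS => //; last exact: IH.
by move=> r rP; apply/negP => rn; apply: n_indiv; exists r.
Qed.

Lemma complexityP_mulr (r n : nat) : r \in P -> 1 < n ->
  complexityP P (r * n) = complexity r + complexityP P n.
Proof.
move=> rP n1; have pr := P_prime rP; have r1 := prime_gt1 pr.
rewrite (@complexityP_div _ _ r) ?mulKn ?dvdn_mulr ?prime_gt0 //; first by nia.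
apply/negP => /P_prime prn; have := dvdn_mulr n (dvdnn r).
by rewrite dvdn_prime2 // => /eqP; nia.
Qed.

Lemma complexityP_expMr (r j n : nat) : r \in P -> 1 < n ->
  complexityP P (r ^ j * n) = j * complexity r + complexityP P n.
Proof.
move=> rP n1; elim: j => [|j IH]; first by rewrite mul1n.
have rj0 : 0 < r ^ j by rewrite expn_gt0 prime_gt0 ?P_prime.
by rewrite expnS -mulnA complexityP_mulr ?IH ?mulSn ?addnA //; nia.
Qed.

Lemma complexityP_addn n i : 0 < n ->
  (forall j r : nat, 0 < j <= i -> r \in P -> ~~ (r %| n + j)) ->
  complexityP P (n + i) = i + complexityP P n.
Proof.
move=> n0; elim: i => [|i IH] indiv; first by rewrite addn0.
rewrite complexityP_sub ?addnS ?ltnS ?addn_gt0 ?n0 //=; last first.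
  by move=> r; rewrite -addnS; apply: indiv; rewrite ltnSn.
by rewrite IH // => j r /andP[j0 ji]; apply: indiv; rewrite j0 leqW.
Qed.

Section LeastPrime.
Variable q : nat.
Hypothesis q_in : q \in P.
Hypothesis q_min : forall r : nat, r \in P -> q <= r.

Lemma complexityP_mul_pred n : (forall r : nat, r \in P -> r %| n) -> 2 < n ->
  complexityP P (q * n).-1 = complexity q + q.-1 + complexityP P n.-1.
Proof.
move=> Pn n2; have q1 := prime_gt1 (P_prime q_in).
have -> : (q * n).-1 = q * n.-1 + q.-1 by nia.
rewrite complexityP_addn; first by rewrite complexityP_mulr //; lia.
  by nia.
move=> j r /andP[j0 jq] rP; apply/negP => r_dvd.
have /dvdn_leq : r %| q - j.
  rewrite -(dvdn_addr _ r_dvd).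
  suff -> : q * n.-1 + j + (q - j) = q * n by rewrite dvdn_mull ?Pn.
  by nia.
by have := q_min rP; lia.
Qed.

Lemma complexityP_expM_pred k m :
  (forall r : nat, r \in P -> r %| m) -> 2 < m ->
  complexityP P (q ^ k * m).-1 =
  k * (complexity q + q.-1) + complexityP P m.-1.
Proof.
move=> Pm m2; elim: k => [|k IH]; first by rewrite mul1n.
have qk0 : 0 < q ^ k by rewrite expn_gt0 prime_gt0 ?P_prime.
rewrite expnS -mulnA complexityP_mul_pred ?IH ?mulSn ?addnA //; last by nia.
by move=> r rP; rewrite dvdn_mull ?Pm.
Qed.

End LeastPrime.

Lemma exists_common_multiple_gt M :
  exists2 m, M < m & forall r : nat, r \in P -> r %| m.
Proof.
exists (M.+1 * \prod_(r <- P) r) => [|r rP].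
  by rewrite leq_pmulr // big_seq prodn_cond_gt0 // => r /P_prime/prime_gt0.
by rewrite dvdn_mull // (big_rem r) //= dvdn_mulr.
Qed.

End Runs.

Lemma log3_mem_gt0 (R : realType) (r : nat) : r \in P -> 0 < log3 r%:R :> R.
Proof. by move=> rP; rewrite log3_gt0 // ltr1n prime_gt1 ?P_prime. Qed.

Lemma logcomplexityP_expMr (R : realType) (r j n : nat) :
  r \in P -> (1 < n)%N ->
  logcomplexityP R P (r ^ j * n) =
  (j%:R * (complexity r)%:R + (complexityP P n)%:R) /
  (j%:R * log3 r%:R + log3 n%:R).
Proof.
move=> rP n1; have r0 := prime_gt0 (P_prime rP).
by rewrite /logcomplexityP complexityP_expMr // natrD natrM log3_natXM // ltnW.
Qed.

Section Density.
Variables (R : realType) (p q : nat).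
Hypothesis p_in : p \in P.
Hypothesis q_in : q \in P.
Hypothesis q_min : forall r : nat, r \in P -> (q <= r)%N.
Implicit Types a b c : R.

Lemma logcomplexityP_mul_gt a b n : (1 < n)%N ->
  a * log3 p%:R < (b - a) * log3 n%:R ->
  b <= logcomplexityP R P n -> a < logcomplexityP R P (p * n).
Proof.
move=> n1; have log3_p_gt0 := log3_mem_gt0 R p_in.
have log3_n_gt0 : 0 < log3 n%:R :> R by rewrite log3_gt0 ?ltr1n.
rewrite ler_pdivlMr // => small_factor b_le.
rewrite -{1}(expn1 p) logcomplexityP_expMr // !mul1r.
rewrite ltr_pdivlMr ?addr_gt0 //.
by have := ler0n R (complexity p); lra.
Qed.

Lemma exists_logcomplexityP_expM_lt b n : (1 < n)%N -> logcomplexity R p < b ->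
  exists j, logcomplexityP R P (p ^ j * n) < b.
Proof.
move=> n1; have log3_p_gt0 := log3_mem_gt0 R p_in.
have log3_n_gt0 : 0 < log3 n%:R :> R by rewrite log3_gt0 ?ltr1n.
rewrite ltr_pdivrMr // -subr_gt0; set gap := _ - _ => gap_gt0.
pose excess := (complexityP P n)%:R - b * log3 n%:R.
exists (Num.truncn (excess / gap)).+1.
have := truncnS_gt (excess / gap); rewrite ltr_pdivrMr // => excess_lt.
rewrite logcomplexityP_expMr // ltr_pdivrMr; last first.
  exact: addr_gt0 (mulr_gt0 (ltr0Sn _ _) log3_p_gt0) log3_n_gt0.
by move: excess_lt; rewrite /excess /gap; lra.
Qed.

Lemma logcomplexityP_expM_pred_ge k m :
  (forall r : nat, r \in P -> (r %| m)%N) -> (2 < m)%N ->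
  (k%:R * (complexity q + q.-1)%:R) / (k%:R * log3 q%:R + log3 m%:R)
  <= logcomplexityP R P (q ^ k * m).-1.
Proof.
move=> Pm m_gt2; have q0 := prime_gt0 (P_prime q_in).
have n_gt1 : (1 < (q ^ k * m).-1)%N.
  by rewrite ltn_predRL (leq_trans m_gt2) // leq_pmull // expn_gt0 q0.
have /andP[_ log3_n_le] := log3_expM_pred_bounds R k q0 (ltnW m_gt2).
have log3_n_gt0 : 0 < log3 (q ^ k * m).-1%:R :> R by rewrite log3_gt0 ?ltr1n.
apply: ler_pM; rewrite ?invr_ge0 ?mulr_ge0 ?ler0n //.
- exact: ltW (lt_le_trans log3_n_gt0 log3_n_le).
- by rewrite -natrM ler_nat complexityP_expM_pred ?leq_addr.
- by rewrite lef_pV2 // posrE (lt_le_trans log3_n_gt0).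
Qed.

Lemma exists_logcomplexityP_gt a c :
  a < (complexity q + q.-1)%:R / log3 (q%:R : R) ->
  exists n, [/\ (1 < n)%N, c < log3 n%:R & a < logcomplexityP R P n].
Proof.
have log3_q_gt0 := log3_mem_gt0 R q_in.
rewrite ltr_pdivlMr // -subr_gt0; set gap := _ - _ => gap_gt0.
(* [m > 2] keeps [m - 1] above [1], where [complexityP_mulr] fails. *)
have [m m_gt2 Pm] := exists_common_multiple_gt 2.
have log3_m_gt0 : 0 < log3 m%:R :> R by rewrite log3_gt0 // ltr1n ltnW.
pose k := (Num.truncn (Num.max (c / log3 q%:R) (a * log3 m%:R / gap))).+1.
have := truncnS_gt _ : Num.max (c / log3 q%:R) (a * log3 m%:R / gap) < k%:R.
rewrite gt_max !ltr_pdivrMr // => /andP[c_lt a_lt].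
have q0 := prime_gt0 (P_prime q_in).
have /andP[log3_n_ge _] := log3_expM_pred_bounds R k q0 (ltnW m_gt2).
exists (q ^ k * m).-1; split; last 2 first.
- exact: lt_le_trans c_lt log3_n_ge.
- apply: lt_le_trans (logcomplexityP_expM_pred_ge k Pm m_gt2).
  rewrite ltr_pdivlMr ?addr_gt0 ?(mulr_gt0 (ltr0Sn _ _) log3_q_gt0) //.
  by move: a_lt; rewrite /gap; lra.
- by rewrite ltn_predRL (leq_trans m_gt2) // leq_pmull // expn_gt0 q0.
Qed.

Lemma logcomplexityP_dense a b : logcomplexity R p <= a -> a < b ->
  b <= (complexity q + q.-1)%:R / log3 (q%:R : R) ->
  exists n, (1 < n)%N /\ a < logcomplexityP R P n < b.
Proof.
move=> pa ab b_le; have ba0 : 0 < b - a by rewrite subr_gt0.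
have [n [n1 log3_n_large a_lt]] :=
  exists_logcomplexityP_gt (a * log3 p%:R / (b - a)) (lt_le_trans ab b_le).
have pjn_ge j : (n <= p ^ j * n)%N.
  by rewrite leq_pmull // expn_gt0 prime_gt0 // P_prime.
have pjn_gt1 j : (1 < p ^ j * n)%N := leq_trans n1 (pjn_ge j).
have [| | |j ab_j] :=
  @exists_nat_between _ R (fun j => logcomplexityP R P (p ^ j * n)) a b.
- by rewrite mul1n.
- move=> j; rewrite expnS -mulnA; apply: logcomplexityP_mul_gt => //.
  rewrite [ltRHS]mulrC -ltr_pdivrMr // (lt_le_trans log3_n_large) //.
  by rewrite ler_log3 ?posrE ?ltr0n ?ler_nat ?(ltnW (pjn_gt1 j)) ?(ltnW n1).
- exact: exists_logcomplexityP_expM_lt n1 (le_lt_trans pa ab).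
by exists (p ^ j * n)%N.
Qed.

End Density.

Section Finiteness.
Variables (R : realType) (L : R).
Hypothesis L_ge0 : 0 <= L.
Hypothesis L_le : forall r : nat, r \in P -> L <= logcomplexity R r.

Lemma complexityP_ge_log3 : exists K : R,
  forall n, (0 < n)%N -> L * log3 n%:R - K <= (complexityP P n)%:R.
Proof.
have L_log3_le (r : nat) : r \in P -> L * log3 r%:R <= (complexity r)%:R.
  by move=> rP; rewrite -ler_pdivlMr ?L_le ?log3_mem_gt0.
pose n0 := (Num.truncn (L / ln 3)).+1; exists (L * log3 n0%:R).
have K_ge0 : 0 <= L * log3 (n0%:R : R) by rewrite mulr_ge0 ?log3_ge0 ?ler1n.
apply: Palgorithm_step_ind => [|r rP|r n rP n1 IH|n n_gt0 indiv IH].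
- by rewrite /log3 ln1 mul0r mulr0 sub0r (le_trans _ (ler0n _ _)) // oppr_le0.
- by rewrite complexityP_mem // (le_trans _ (L_log3_le _ rP)) // gerBl.
- rewrite complexityP_mulr // natrD -{1}(expn1 r) log3_natXM ?(ltnW n1) //.
    by have := L_log3_le _ rP; lra.
  by rewrite prime_gt0 ?P_prime.
- have [n_le|n0_le] := leqP n.+1 n0.
    rewrite (le_trans _ (ler0n _ _)) // subr_le0 ler_wpM2l //.
    by rewrite ler_log3 ?posrE ?ltr0n ?ler_nat.
  rewrite complexityP_sub //= natrD.
  suff /(mulr_log3S_le L_ge0 n_gt0) : L / ln 3 <= n%:R by lra.
  by rewrite (le_trans (ltW (truncnS_gt _))) ?ler_nat.
Qed.

Lemma finite_logcomplexityP_lt (eps : R) : 0 < eps ->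
  finite_set [set n : nat | (1 < n)%N /\ logcomplexityP R P n < L - eps].
Proof.
move=> eps0; have [K K_le] := complexityP_ge_log3.
apply: sub_finite_set (finite_log3_le (K / eps)) => n /= [n1].
rewrite ltr_pdivrMr ?log3_gt0 ?ltr1n // ler_pdivlMr //.
by have := K_le _ (ltnW n1); lra.
Qed.

End Finiteness.
End Palgorithm.

Theorem theorem4 (R : realType) (P : {fset nat}) (q p : nat)
  (P_neq0 : P != fset0)
  (P_prime : forall r : nat, r \in P -> prime r)
  (q_in : q \in P)
  (q_min : forall r : nat, r \in P -> (q <= r)%N)
  (p_in : p \in P)
  (p_min : forall r : nat, r \in P -> logcomplexity R p <= logcomplexity R r) :
  (forall a b : R,
      logcomplexity R p <= a -> a < b ->
      b <= logcomplexity R q + (q%:R - 1) / log3 q%:R ->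
      exists n : nat, (1 < n)%N /\ a < logcomplexityP R P n < b) /\
  (forall eps : R, 0 < eps ->
      finite_set [set n : nat | (1 < n)%N /\
        3 <= logcomplexityP R P n < logcomplexity R p - eps]).
Proof.
have q0 := prime_gt0 (P_prime q q_in); have p0 := prime_gt0 (P_prime p p_in).
split=> [a b pa ab b_le|eps eps0].
  apply: (logcomplexityP_dense P_prime p_in q_in q_min pa ab).
  by rewrite natrD -subn1 natrB // mulrDl.
have := finite_logcomplexityP_lt P_prime (logcomplexity_ge0 R p0) p_min eps0.
by apply: sub_finite_set => n /= [n1 /andP[_]].
Qed.
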